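(* Let $r$ be a positive integer or $r=\infty$. The operator $G^\vee_r(z)$ commutes with taking Schur determinants: for every $\boldsymbol{\lambda}\in\mathcal{P}_r$, $$G^\vee_r(z)\Delta_{\boldsymbol{\lambda}}(H_r)=\Delta_{\boldsymbol{\lambda}}(G^\vee_r(z)H_r),$$ where $G^\vee_r(z)H_r=(G^\vee_r(z)h_n)_{n\in\mathbb{Z}}$, and consequently $$\Gamma^\vee_r(z)\Delta_{\boldsymbol{\lambda}}(H_r)=\frac{E_r(z)}{z}\,\Delta_{\boldsymbol{\lambda}}(G^\vee_r(z)H_r).$$
   Context: Let $r\in\{1,2,3,\dots\}\cup\{\infty\}$. $B_r=\mathbb{Q}[e_i : i\in\mathbb{N},\ 1\le i\le r]$ is a polynomial ring; $e_0=1$ and $e_i=0$ for $i>r$. $E_r(t)=1+\sum_{1\le i\le r}(-1)^ie_it^i\in B_r[[t]]$, and $H_r=(h_n)_{n\in\mathbb{Z}}$ is defined by $\sum_{n\in\mathbb{Z}}h_nt^n=1/E_r(t)$ (so $h_n=0$ for $n<0$, $h_0=1$). $\mathcal{P}_r$ is the set of partitions $\boldsymbol{\lambda}=(\lambda_1\ge\lambda_2\ge\cdots)$ with at most $r$ nonzero parts (all partitions if $r=\infty$). For a sequence $a=(a_n)_{n\in\mathbb{Z}}$ in a commutative ring, $\Delta_{\boldsymbol{\lambda}}(a)=\det(a_{\lambda_j-j+i})_{1\le i,j\le k}$, where $k=r$ if $r<\infty$, and $k$ is any integer at least the length of $\boldsymbol{\lambda}$ if $r=\infty$ (the value does not depend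 on $k$ for sequences with $a_0=1$ and $a_n=0$ for $n<0$). It is known that $(\Delta_{\boldsymbol{\lambda}}(H_r))_{\boldsymbol{\lambda}\in\mathcal{P}_r}$ is a $\mathbb{Q}$-basis of $B_r$. For $j\in\mathbb{Z}$ let $u_j=\sum_{n\ge0}h_{n+j}\frac{t^n}{n!}\in B_r[[t]]$ (linearly independent over $\mathbb{Q}$). Semi-infinite exterior monomials $u_{i_0}\wedge u_{i_1}\wedge\cdots$ (with $i_{m+1}=i_m-1$ for all large $m$) are formal symbols over $\mathbb{Q}$, alternating in their entries. Put $\Phi^r_{i,\boldsymbol{\lambda}}=u_{i+\lambda_1}\wedge u_{i-1+\lambda_2}\wedge u_{i-2+\lambda_3}\wedge\cdots$ (with $\lambda_m=0$ beyond the length of $\boldsymbol{\lambda}$), $\Phi^r_0=\Phi^r_{0,(0)}$. Contraction with the dual vector $u_i^\vee$ ($u_i^\vee(u_j)=\delta_{ij}$) is $u_i^\vee\lrcorner(u_{i_0}\wedge u_{i_1}\wedge\cdots)=\sum_{m\ge0}(-1)^m\delta_{i,i_m}\,u_{i_0}\wedge\cdots\wedge\widehat{u_{i_m}}\wedge\cdots$ (hat means omitted). For $\phi=\sum_{n\ge0}a_n\frac{t^n}{n!}\in B_r[[t]]$ and $k\in\mathbb{N}$ let $U_k(\phi)=a_k+\sum_{i\ge1}(-1)^ie_ia_{k-i}$, where $a_j=0$ for $j<0$; then $\phi=\sum_{i\ge0}U_i(\phi)u_{-i}$. For a monomial $\alpha=u_{i_0}\wedge u_{i_1}\wedge\cdots$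 with $i_m=-m$ for all $m\ge k$, put $[\alpha]=(\alpha\otimes_{\mathbb{Q}}1_{B_r})/\Phi^r_0=\det\big(U_a(u_{i_b})\big)_{0\le a,b\le k-1}\in B_r$ (independent of $k$; this is the result of expanding each $u_{i_b}$ $B_r$-linearly in the $u_{-a}$, $a\ge0$). Extend $[\cdot]$ $\mathbb{Q}$-linearly. The vertex operator $\Gamma^\vee_r(z)$ is the $\mathbb{Q}$-linear map on $B_r$ with $\Gamma^\vee_r(z)\Delta_{\boldsymbol{\lambda}}(H_r)=\sum_{i\in\mathbb{Z}}[u_i^\vee\lrcorner\Phi^r_{1,\boldsymbol{\lambda}}]\,z^{-i}$ for $\boldsymbol{\lambda}\in\mathcal{P}_r$. Only finitely many negative powers of $z$ occur, so the values lie in the Laurent series ring $B_r((z))$. $G^\vee_r(z)$ is the $\mathbb{Q}$-linear map with $G^\vee_r(z)\Delta_{\boldsymbol{\lambda}}(H_r)=\dfrac{z\,\Gamma^\vee_r(z)\Delta_{\boldsymbol{\lambda}}(H_r)}{E_r(z)}=\big(z\,\Gamma^\vee_r(z)\Delta_{\boldsymbol{\lambda}}(H_r)\big)\sum_{n\ge0}h_nz^n$. *)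

(* Defs.v *)
From HB Require Import structures.
From mathcomp Require Import all_boot all_order all_algebra perm finmap.
From mathcomp Require Import boolp classical_sets functions cardinality fsbigop.
From mathcomp Require Import monalg zify.

Set Implicit Arguments.
Unset Strict Implicit.
Unset Printing Implicit Defensive.

Import Order.TTheory GRing.Theory Num.Theory.
Local Open Scope ring_scope.
Local Open Scope quotient_scope.

(* Formal Laurent series R((z)), encoded by their coefficient functions; *)
(* inverses exist by classical choice, see pser_unit and lvar_unit.      *)

Section LaurentZmod.
Context (R : comNzRingType).

Definition laurent_pred (f : int -> R) : bool :=
  `[< exists N : int, forall n : int, n < N -> f n = 0 >].

Fact laurent_pred_zmod : zmod_closed laurent_pred.
Proof.
split; first by apply/asboolP; exists 0.
move=> f g /asboolP[N hN] /asboolP[M hM]; apply/asboolP.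
exists (Order.min N M) => n; rewrite lt_min => /andP[nN nM].
by rewrite !fctE hN // hM // subr0.
Qed.

HB.instance Definition _ :=
  GRing.isZmodClosed.Build (int -> R) laurent_pred laurent_pred_zmod.

Record laurent := Laurent {
  lcoef :> int -> R;
  laurent_lb : laurent_pred lcoef }.

HB.instance Definition _ := [isSub for lcoef].
HB.instance Definition _ := [Choice of laurent by <:].
HB.instance Definition _ := [SubChoice_isSubZmodule of laurent by <:].

Lemma laurentP (f g : laurent) : (forall n, f n = g n) -> f = g.
Proof. by move=> fg; apply: val_inj; apply: funext. Qed.

Lemma laurent_ex (f : laurent) :
  exists N : int, forall n : int, n < N -> f n = 0.
Proof. exact/asboolP/laurent_lb. Qed.

Definition mk_laurent (f : int -> R)
  (hf : exists N : int, forall n : int, n < N -> f n = 0) := Laurent (asboolT hf).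

Lemma lcoefD (f g : laurent) n : (f + g) n = f n + g n.
Proof. by []. Qed.

Lemma lcoefN (f : laurent) n : (- f) n = - f n.
Proof. by []. Qed.

Lemma lcoef0 n : (0 : laurent) n = 0.
Proof. by []. Qed.

(* For fixed n, the summand vanishes for all but finitely many i. *)
Definition lmul_coef (f g : laurent) (n : int) : R :=
  \sum_(i \in [set: int]) f i * g (n - i).

Lemma lmul_coefE (f g : laurent) (N M : int) :
    (forall n : int, n < N -> f n = 0) -> (forall n : int, n < M -> g n = 0) ->
  forall n : nat, lmul_coef f g (N + M + n%:Z) =
    \sum_(i < n.+1) f (N + i%:Z) * g (M + (n - i)%N%:Z).
Proof.
move=> fN gM n; pose s := [seq N + i%:Z | i <- iota 0 n.+1].
have us : uniq s.
  by rewrite map_inj_uniq ?iota_uniq // => i j /addrI[].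
rewrite /lmul_coef.
have -> : [set: int]%classic = [set` (predT : pred int)]%classic.
  by apply/seteqP; split.
rewrite -(@bigfs _ _ _ _ s) //; last first.
  move=> i _ is_; case: (ltP i N) => [/fN->|Ni]; first by rewrite mul0r.
  rewrite gM ?mulr0 //; move: is_; apply: contraR; rewrite -leNgt => Mi.
  apply/mapP; exists `|i - N|%N; last by lia.
  by rewrite mem_iota; lia.
rewrite big_map -[iota _ _]/(index_iota 0 n.+1) big_mkord.
by apply: eq_bigr => i _; congr (_ * g _); have := ltn_ord i; lia.
Qed.

Lemma lmul_coef0 (f g : laurent) (N M : int) :
    (forall n : int, n < N -> f n = 0) -> (forall n : int, n < M -> g n = 0) ->
  forall n : int, n < N + M -> lmul_coef f g n = 0.
Proof.
move=> fN gM n nNM; apply: fsbig1 => i _.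
case: (ltP i N) => [/fN->|Ni]; first by rewrite mul0r.
by rewrite gM ?mulr0 //; lia.
Qed.

Fact lmul_subproof (f g : laurent) :
  exists N : int, forall n : int, n < N -> lmul_coef f g n = 0.
Proof.
have [N fN] := laurent_ex f; have [M gM] := laurent_ex g.
by exists (N + M); apply: lmul_coef0.
Qed.

Definition lmul f g : laurent := mk_laurent (lmul_subproof f g).

Definition lmonom_coef (k n : int) : R := (n == k)%:R.

Fact lmonom_subproof k :
  exists N : int, forall n : int, n < N -> lmonom_coef k n = 0.
Proof. by exists k => n nk; rewrite /lmonom_coef lt_eqF. Qed.

Definition lmonom k : laurent := mk_laurent (lmonom_subproof k).

Let tr N K (f : laurent) : {poly R} := \poly_(i < K) f (N + i%:Z).

Let lmul_tr (f g : laurent) (N M : int) K (n : nat) :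
    (forall n : int, n < N -> f n = 0) -> (forall n : int, n < M -> g n = 0) ->
  (n < K)%N -> lmul f g (N + M + n%:Z) = (tr N K f * tr M K g)`_n.
Proof.
move=> fN gM nK; rewrite [LHS](lmul_coefE fN gM) coefM.
by apply: eq_bigr => i _; rewrite !coef_poly !ifT //; have := ltn_ord i; lia.
Qed.

Let lmul_lb (f g : laurent) (N M : int) :
    (forall n : int, n < N -> f n = 0) -> (forall n : int, n < M -> g n = 0) ->
  forall n : int, n < N + M -> lmul f g n = 0.
Proof. exact: lmul_coef0. Qed.

Let laurent_split (P : int -> Prop) (N : int) :
  (forall n : int, n < N -> P n) -> (forall n : nat, P (N + n%:Z)) -> forall n, P n.
Proof.
move=> h1 h2 n; case: (ltP n N) => [/h1//|Nn].
by have := h2 `|n - N|%N; congr P; lia.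
Qed.

Fact lmulC : commutative lmul.
Proof.
move=> f g; apply: laurentP.
have [N fN] := laurent_ex f; have [M gM] := laurent_ex g.
apply: (laurent_split (N := N + M)) => n.
  by move=> nl; rewrite (lmul_lb fN gM) // (lmul_lb gM fN) // addrC.
by rewrite (lmul_tr (K := n.+1) fN gM) // mulrC -lmul_tr // [N + M]addrC.
Qed.

Fact lmulA : associative lmul.
Proof.
move=> f g h; apply: laurentP.
have [N fN] := laurent_ex f; have [M gM] := laurent_ex g.
have [Q hQ] := laurent_ex h.
apply: (laurent_split (N := N + (M + Q))) => n.
  move=> nl; rewrite (lmul_lb fN (lmul_lb gM hQ)) //.
  by rewrite (lmul_lb (lmul_lb fN gM) hQ) // -addrA.
rewrite (lmul_tr (K := n.+1) fN (lmul_lb gM hQ)) // addrA.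
rewrite (lmul_tr (K := n.+1) (lmul_lb fN gM) hQ) //.
transitivity ((tr N n.+1 f * (tr M n.+1 g * tr Q n.+1 h))`_n).
  rewrite !coefM; apply: eq_bigr => i _; congr (_ * _).
  have ni : (n - i < n.+1)%N by lia.
  by rewrite coef_poly ni (lmul_tr (K := n.+1) gM hQ ni).
rewrite mulrA !coefM; apply: eq_bigr => i _; congr (_ * _).
by rewrite [RHS]coef_poly ltn_ord (lmul_tr fN gM (ltn_ord i)).
Qed.

Lemma lmul_monomE k (f : laurent) n : lmul (lmonom k) f n = f (n - k).
Proof.
rewrite /= /lmul_coef (fsbigTE [fset k]%fset).
  by rewrite big_seq_fset1 /= /lmonom_coef eqxx mul1r.
by move=> i; rewrite inE => /negPf ik; rewrite /= /lmonom_coef ik mul0r.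
Qed.

Fact lmul1 : left_id (lmonom 0) lmul.
Proof. by move=> f; apply: laurentP => n; rewrite lmul_monomE subr0. Qed.

Fact lmulDl : left_distributive lmul +%R.
Proof.
move=> f g h; apply: laurentP.
have [N0 fN0] := laurent_ex f; have [N1 gN1] := laurent_ex g.
have [Q hQ] := laurent_ex h.
pose N := Order.min N0 N1.
have fN n : n < N -> f n = 0 by rewrite lt_min => /andP[/fN0].
have gN n : n < N -> g n = 0 by rewrite lt_min => /andP[_ /gN1].
have fgN n : n < N -> (f + g) n = 0.
  by move=> nN; rewrite lcoefD fN ?gN ?addr0.
apply: (laurent_split (N := N + Q)) => n.
  by move=> nl; rewrite lcoefD !(lmul_lb _ hQ nl) ?addr0.
rewrite lcoefD (lmul_tr (K := n.+1) fgN hQ) // !(@lmul_tr _ h N Q n.+1) //.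
rewrite -coefD -mulrDl; congr ((_ : {poly R})`_n); congr (_ * _).
by apply/polyP => i; rewrite coefD !coef_poly; case: ifP; rewrite ?addr0.
Qed.

Fact lmonom0_neq0 : lmonom 0 != 0.
Proof.
apply/eqP => /(congr1 (fun f : laurent => f 0)) /eqP.
by rewrite lcoef0 /= /lmonom_coef eqxx oner_eq0.
Qed.

HB.instance Definition _ :=
  GRing.Zmodule_isComNzRing.Build laurent lmulA lmulC lmul1 lmulDl lmonom0_neq0.

Definition lunit : pred laurent := fun f => `[< exists g, g * f = 1 >].

Definition linv (f : laurent) : laurent :=
  if pselect (exists g, g * f = 1) is left ex then projT1 (cid ex) else f.

Fact lmulVr : {in lunit, left_inverse 1 linv *%R}.
Proof.
move=> f /asboolP fu; rewrite /linv; case: pselect => // ex.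
by case: (cid ex).
Qed.

Fact lunitPl (f g : laurent) : g * f = 1 -> lunit f.
Proof. by move=> fg; apply/asboolP; exists g. Qed.

Fact linv_out : {in [predC lunit], linv =1 id}.
Proof.
move=> f /negP fu; rewrite /linv; case: pselect => // ex.
by case: fu; apply/asboolP.
Qed.

HB.instance Definition _ :=
  GRing.ComNzRing_hasMulInverse.Build laurent lmulVr lunitPl linv_out.

Lemma lcoefM (f g : laurent) n :
  (f * g) n = \sum_(i \in [set: int]) f i * g (n - i).
Proof. by []. Qed.

Lemma lcoef1 n : (1 : laurent) n = (n == 0)%:R.
Proof. by []. Qed.

Definition lvar : laurent := lmonom 1.

Lemma lvar_unit : lvar \is a GRing.unit.
Proof.
apply: (@lunitPl _ (lmonom (-1))); apply: laurentP => n.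
by rewrite [LHS]lmul_monomE /= /lmonom_coef; congr (_%:R); lia.
Qed.

Definition pser_coef (a : nat -> R) (n : int) : R :=
  if n is Posz m then a m else 0.

Fact pser_subproof a :
  exists N : int, forall n : int, n < N -> pser_coef a n = 0.
Proof. by exists 0 => -[]. Qed.

Definition pser a : laurent := mk_laurent (pser_subproof a).

Lemma pser_lt0 a n : n < 0 -> pser a n = 0.
Proof. by case: n. Qed.

Lemma lcoef_pserM a (f : laurent) : (forall n : int, n < 0 -> f n = 0) ->
  forall n : nat, (pser a * f) n%:Z = \sum_(i < n.+1) a i * f (n - i)%N%:Z.
Proof.
move=> f0 n; have := lmul_coefE (pser_lt0 a) f0 n.
rewrite !add0r => e; rewrite [LHS]e.
by apply: eq_bigr => i _; rewrite !add0r.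
Qed.

Fixpoint pser_inv_seq (a : nat -> R) (n : nat) : seq R :=
  if n is m.+1 then
    let s := pser_inv_seq a m in
    rcons s (if m == 0%N then 1
             else - \sum_(i < m) a i.+1 * nth 0 s (m - i.+1))
  else [::].

Fact pser_invP a : a 0%N = 1 ->
  exists2 b : nat -> R, b 0%N = 1 & pser b * pser a = 1.
Proof.
move=> a0; pose b n := nth 0 (pser_inv_seq a n.+1) n.
have szb n : size (pser_inv_seq a n) = n.
  by elim: n => //= n IH; rewrite size_rcons IH.
have nthb n m : (m < n)%N -> nth 0 (pser_inv_seq a n) m = b m.
  elim: n => // n IH; rewrite ltnS leq_eqVlt => /orP[/eqP->//|mn].
  by rewrite /= nth_rcons szb mn IH.
have bE n : b n = if n == 0%N then 1 else
     - \sum_(i < n) a i.+1 * b (n - i.+1)%N.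
  rewrite /b /= nth_rcons szb ltnn eqxx; case: eqP => // _; congr (- _).
  by apply: eq_bigr => i _; rewrite nthb //; have := ltn_ord i; lia.
exists b; first by rewrite bE.
rewrite mulrC; apply: laurentP => -[n|n]; last first.
  by rewrite [LHS](lmul_coef0 (pser_lt0 a) (pser_lt0 b)).
rewrite lcoef_pserM; last exact: pser_lt0.
rewrite [RHS]lcoef1 big_ord_recl a0 mul1r subn0 /= bE.
case: n => [|n]; first by rewrite big_ord0 addr0.
by rewrite /= addNr.
Qed.

Lemma pser_unit a : a 0%N = 1 -> pser a \is a GRing.unit.
Proof. by move=> /pser_invP[b _ /lunitPl]. Qed.

Lemma pser_inv a : a 0%N = 1 ->
  exists2 b : nat -> R, b 0%N = 1 & (pser a)^-1 = pser b.
Proof.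
move=> a0; have [b b0 ba] := pser_invP a0; exists b => //.
by apply: (mulIr (pser_unit a0)); rewrite mulVr ?pser_unit.
Qed.

End LaurentZmod.

Section LaurentLmod.
Context (K : pzRingType) (A : comAlgType K).

Fact lscale_subproof (c : K) (f : laurent A) :
  exists N : int, forall n : int, n < N -> c *: f n = 0.
Proof.
by have [N fN] := laurent_ex f; exists N => n /fN->; rewrite scaler0.
Qed.

Definition lscale c f : laurent A := mk_laurent (lscale_subproof c f).

Fact lscaleA c d f : lscale c (lscale d f) = lscale (c * d) f.
Proof. by apply: laurentP => n /=; rewrite scalerA. Qed.

Fact lscale1 : left_id 1 lscale.
Proof. by move=> f; apply: laurentP => n /=; rewrite scale1r. Qed.

Fact lscaleDr : right_distributive lscale +%R.
Proof. by move=> c f g; apply: laurentP => n /=; rewrite scalerDr. Qed.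

Fact lscaleDl f : {morph lscale^~ f : c d / c + d}.
Proof. by move=> c d; apply: laurentP => n /=; rewrite scalerDl. Qed.

HB.instance Definition _ := GRing.Zmodule_isLmodule.Build K (laurent A)
  lscaleA lscale1 lscaleDr lscaleDl.
End LaurentLmod.

(* Values r : option nat stand for r in N or r = oo, with None = oo.     *)

Definition le_oo (i : nat) (r : option nat) : bool :=
  if r is Some s then (i <= s)%N else true.

Definition evar (r : option nat) : choiceType := {i : nat | (0 < i)%N && le_oo i r}.

Definition Bring (r : option nat) : comAlgType rat := {malg rat[{cmonom (evar r)}]}.

Definition e_ (r : option nat) (i : nat) : Bring r :=
  if i == 0%N then 1
  else if insub i is Some j then << ucm (j : evar r) >> else 0.

Lemma e_0 r : e_ r 0 = 1.
Proof. by []. Qed.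

Definition Eser (r : option nat) : laurent (Bring r) :=
  pser (fun i => (-1) ^+ i * e_ r i).

Lemma Eser_unit r : Eser r \is a GRing.unit.
Proof. by apply: pser_unit; rewrite mul1r. Qed.

Definition h_ (r : option nat) (n : int) : Bring r := (Eser r)^-1 n.

Lemma h_lt0 r (n : int) : n < 0 -> h_ r n = 0.
Proof.
have [|b _] := @pser_inv _ (fun i => (-1) ^+ i * e_ r i); first by rewrite mul1r.
by rewrite /h_ /Eser => -> /(pser_lt0 b).
Qed.

Lemma h_0 r : h_ r 0 = 1.
Proof.
have [|b b0] := @pser_inv _ (fun i => (-1) ^+ i * e_ r i); first by rewrite mul1r.
by rewrite /h_ /Eser => ->.
Qed.

Lemma eh_sum r (n : nat) :
  \sum_(i < n.+1) (-1) ^+ i * e_ r i * h_ r (n - i)%N%:Z = (n == 0%N)%:R.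
Proof.
have := lcoef_pserM (fun i => (-1) ^+ i * e_ r i) (f := (Eser r)^-1) (@h_lt0 r) n.
by rewrite -/(Eser r) divrr ?Eser_unit // lcoef1 => ->.
Qed.

(* Partitions with at most r parts, as lists of their nonzero parts.     *)

Definition is_part (r : option nat) (la : seq nat) : bool :=
  [&& sorted geq la, 0%N \notin la & le_oo (size la) r].

(* The sizes k for which schur_det k la is the determinant of la: k = r   *)
(* if r is finite, any k >= size la if r = oo.                            *)
Definition schur_size (r : option nat) (la : seq nat) (k : nat) : bool :=
  if r is Some s then k == s else (size la <= k)%N.

(* Rows and columns are numbered from 0, which leaves j - i unchanged. *)
Definition schur_det (R : comNzRingType) (k : nat) (la : seq nat)
    (a : int -> R) : R :=
  \det (\matrix_(i < k, j < k) a ((nth 0%N la j)%:Z - j%:Z + i%:Z)).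

Lemma det_last_col (R : comNzRingType) (k : nat) (M : nat -> nat -> R) :
  (forall i, (i <= k)%N -> M i k = (i == k)%:R) ->
  \det (\matrix_(i < k.+1, j < k.+1) M i j) = \det (\matrix_(i < k, j < k) M i j).
Proof.
move=> Mk; rewrite (expand_det_col _ ord_max) (bigD1 ord_max) //=.
rewrite big1 ?addr0 => [|i /eqP ik].
  rewrite mxE /= Mk // eqxx mul1r /cofactor /= addnn -signr_odd odd_double mul1r.
  by congr (\det _); apply/matrixP => i j; rewrite !mxE !lift_max.
rewrite mxE /= Mk ?leq_ord //; case: eqP => [e|_]; last by rewrite mul0r.
by case: ik; apply: val_inj.
Qed.

Lemma schur_det_size (R : comNzRingType) (k : nat) (la : seq nat) (a : int -> R) :
  a 0 = 1 -> (forall n : int, n < 0 -> a n = 0) -> (size la <= k)%N ->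
  schur_det k la a = schur_det (size la) la a.
Proof.
move=> a0 an0 /subnK <-; elim: (k - size la)%N => //= n <-.
rewrite addSn; apply: (@det_last_col _ _
  (fun i j => a ((nth 0%N la j)%:Z - j%:Z + i%:Z))) => i ik.
rewrite nth_default ?leq_addl // sub0r.
case: eqP => [->|ne]; first by rewrite addNr.
by apply: an0; lia.
Qed.

(* A power series in t is encoded by the function n |-> its coefficient  *)
(* of t^n (not of t^n / n!, which is tcoef below).                       *)

Definition u_ (r : option nat) (j : int) (n : nat) : Bring r :=
  (n`!%:R : rat)^-1 *: h_ r (n%:Z + j).

Definition tcoef (r : option nat) (phi : nat -> Bring r) (n : nat) : Bring r :=
  phi n *+ n`!.

Definition U_ (r : option nat) (k : nat) (phi : nat -> Bring r) : Bring r :=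
  tcoef phi k +
    \sum_(1 <= i < k.+1) (-1) ^+ i * e_ r i * tcoef phi (k - i).

Lemma tcoef_u r j n : tcoef (u_ r j) n = h_ r (n%:Z + j).
Proof.
rewrite /tcoef /u_ -scaler_nat scalerA mulfV ?scale1r //.
by rewrite pnatr_eq0 -lt0n fact_gt0.
Qed.

Lemma U_u r k j : U_ k (u_ r j) =
  \sum_(i < k.+1) (-1) ^+ i * e_ r i * h_ r ((k - i)%N%:Z + j).
Proof.
rewrite /U_ tcoef_u big_ord_recl e_0 expr0 !mul1r subn0; congr (_ + _).
rewrite big_add1 big_mkord; apply: eq_bigr => i _.
by rewrite tcoef_u.
Qed.

Lemma U_uN r k (a : nat) : (a <= k)%N -> U_ a (u_ r (- k%:Z)) = (a == k)%:R.
Proof.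
move=> ak; rewrite U_u.
move: ak; rewrite leq_eqVlt => /orP[/eqP->|ak].
  rewrite big_ord_recl e_0 expr0 subn0 subrr h_0 !mul1r eqxx big1 ?addr0 // => i _.
  by rewrite h_lt0 ?mulr0 //= /bump; have := ltn_ord i; lia.
rewrite (ltn_eqF ak) big1 // => i _.
by rewrite h_lt0 ?mulr0 //; have := ltn_ord i; lia.
Qed.

(* Semi-infinite exterior monomials of charge c; s lists the indices i_m *)
(* of u_{i_0} /\ u_{i_1} /\ ..., so that s m = c - m for large m.        *)

Definition wmono_pred (c : int) (s : nat -> int) : bool :=
  `[< exists k, forall m, (k <= m)%N -> s m = c - m%:Z >].

Record wmono (c : int) := WMono {
  wm_val :> nat -> int;
  wm_charge : wmono_pred c wm_val }.

HB.instance Definition _ c := [isSub for @wm_val c].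
HB.instance Definition _ c := [Choice of wmono c by <:].

Definition mk_wmono c (s : nat -> int)
  (hs : exists k, forall m, (k <= m)%N -> s m = c - m%:Z) : wmono c :=
  WMono (asboolT hs).

Lemma wmono_ex c (s : wmono c) :
  exists k, forall m, (k <= m)%N -> s m = c - m%:Z.
Proof. exact/asboolP/wm_charge. Qed.

Lemma wmonoP c (s t : wmono c) : (forall m, s m = t m) -> s = t.
Proof. by move=> st; apply: val_inj; apply: funext. Qed.

Definition adj (m j : nat) : nat :=
  if j == m then m.+1 else if j == m.+1 then m else j.

Fact wswap_subproof c m (s : wmono c) :
  exists k, forall j, (k <= j)%N -> s (adj m j) = c - j%:Z.
Proof.
have [k hk] := wmono_ex s; exists (k + m.+2)%N => j kj.
rewrite /adj; case: eqP => [|_]; first by lia.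
by case: eqP => [|_]; [lia|apply: hk; lia].
Qed.

Definition wswap c m (s : wmono c) : wmono c := mk_wmono (wswap_subproof m s).

Fact wdel_subproof c m (s : wmono c) :
  exists k, forall j, (k <= j)%N -> s (bump m j) = c - 1 - j%:Z.
Proof.
have [k hk] := wmono_ex s; exists (k + m)%N => j kj.
by rewrite /bump hk; lia.
Qed.

Definition wdel c m (s : wmono c) : wmono (c - 1) :=
  mk_wmono (wdel_subproof m s).

(* The charge c part of the semi-infinite exterior power: formal linear  *)
(* combinations of monomials modulo alternation. Adjacent transpositions *)
(* suffice: see wedge_tperm and wedge_eq0.                               *)

Section Fock.
Context (c : int).

Definition alt_rel : pred {malg rat[wmono c]} := fun x =>
  `[< exists l : seq (rat * (nat * wmono c)),
      x = \sum_(t <- l) t.1 *: (<< t.2.2 >> + << wswap t.2.1 t.2.2 >>) >].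

Fact alt_rel_zmod : zmod_closed alt_rel.
Proof.
split; first by apply/asboolP; exists [::]; rewrite big_nil.
move=> x y /asboolP[lx ->] /asboolP[ly ->]; apply/asboolP.
exists (lx ++ [seq (- t.1, t.2) | t <- ly]).
rewrite big_cat big_map /= -sumrN; congr (_ + _).
by apply: eq_bigr => t _; rewrite scaleNr.
Qed.

HB.instance Definition _ :=
  GRing.isZmodClosed.Build {malg rat[wmono c]} alt_rel alt_rel_zmod.

Definition fock := ring_quotient.Quotient.quot (GRing.ZmodClosed.clone _ alt_rel _).

HB.instance Definition _ := GRing.Zmodule.on fock.
HB.instance Definition _ := Quotient.on fock.

End Fock.

Section FockLmod.
Context (c : int).
Implicit Types (x y : {malg rat[wmono c]}) (v w : fock c).

Lemma pi_fock_eq x y : (\pi_(fock c) x = \pi_(fock c) y) <-> x - y \in @alt_rel c.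
Proof.
rewrite ring_quotient.Quotient.idealrBE.
by split => [e|/eqP//]; apply/eqP.
Qed.

Lemma pi_fockD x y : \pi_(fock c) (x + y) = \pi_(fock c) x + \pi_(fock c) y.
Proof. by rewrite !piE. Qed.

Fact alt_relZ (a : rat) x : x \in @alt_rel c -> a *: x \in @alt_rel c.
Proof.
move=> /asboolP[l ->]; apply/asboolP.
exists [seq (a * t.1, t.2) | t <- l].
by rewrite big_map scaler_sumr; apply: eq_bigr => t _; rewrite scalerA.
Qed.

Definition fock_scale (a : rat) v : fock c := \pi_(fock c) (a *: repr v).

Lemma pi_fock_scale a x : fock_scale a (\pi_(fock c) x) = \pi_(fock c) (a *: x).
Proof.
apply/pi_fock_eq; rewrite -scalerBr; apply: alt_relZ.
by apply/pi_fock_eq; rewrite reprK.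
Qed.

Fact fock_scaleA a b v : fock_scale a (fock_scale b v) = fock_scale (a * b) v.
Proof.
rewrite -[v]reprK (pi_fock_scale b (repr v)) (pi_fock_scale a (b *: _)).
by rewrite (pi_fock_scale (a * b)) scalerA.
Qed.

Fact fock_scale1 : left_id 1 fock_scale.
Proof. by move=> v; rewrite -[v]reprK !pi_fock_scale scale1r. Qed.

Fact fock_scaleDr : right_distributive fock_scale +%R.
Proof.
move=> a v w; rewrite -[v]reprK -[w]reprK.
by rewrite -pi_fockD !pi_fock_scale -pi_fockD scalerDr.
Qed.

Fact fock_scaleDl v : {morph fock_scale^~ v : a b / a + b}.
Proof.
by move=> a b; rewrite -[v]reprK !pi_fock_scale -pi_fockD scalerDl.
Qed.

HB.instance Definition _ := GRing.Zmodule_isLmodule.Build rat (fock c)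
  fock_scaleA fock_scale1 fock_scaleDr fock_scaleDl.

Lemma pi_fockZ a x : \pi_(fock c) (a *: x) = a *: \pi_(fock c) x.
Proof. by rewrite -pi_fock_scale. Qed.

Definition wedge (s : wmono c) : fock c := \pi_(fock c) << s >>.

Lemma wedge_swap m (s : wmono c) : wedge (wswap m s) = - wedge s.
Proof.
apply/eqP; rewrite -addr_eq0 addrC -pi_fockD; apply/eqP.
rewrite -[RHS](_ : \pi_(fock c) 0 = 0); last by rewrite !piE.
apply/pi_fock_eq; rewrite subr0; apply/asboolP.
by exists [:: (1, (m, s))]; rewrite big_seq1 scale1r.
Qed.

(* The linear extension of a function defined on monomials; it is only   *)
(* meaningful for an alternating function F (see fock_lift_pi).           *)
Definition malg_lift (V : lmodType rat) (F : wmono c -> V) x : V :=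
  \sum_(k <- msupp x) x@_k *: F k.

Definition fock_lift (V : lmodType rat) (F : wmono c -> V) v : V :=
  malg_lift F (repr v).

Section Lift.
Context (V : lmodType rat) (F : wmono c -> V).

Lemma malg_liftEw (d : {fset wmono c}) x : (msupp x `<=` d)%fset ->
  malg_lift F x = \sum_(k <- d) x@_k *: F k.
Proof.
move=> le; rewrite /malg_lift (big_fset_incl _ le) // => k _ /mcoeff_outdom ->.
by rewrite scale0r.
Qed.

Lemma malg_liftU s : malg_lift F << s >> = F s.
Proof.
by rewrite (malg_liftEw (d := [fset s]%fset)) ?msuppU_le // big_seq_fset1
  mcoeffUU scale1r.
Qed.

Lemma malg_lift_linear : linear (malg_lift F).
Proof.
move=> a x y.
pose d := (msupp x `|` msupp y `|` msupp (a *: x + y))%fset.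
rewrite !(malg_liftEw (d := d)).
- rewrite scaler_sumr -big_split /=; apply: eq_bigr => k _.
  by rewrite mcoeffD mcoeffZ scalerDl scalerA.
- by rewrite /d -fsetUA; apply/fsubsetP => k; rewrite !inE => ->; rewrite ?orbT.
- by apply/fsubsetP => k; rewrite !inE => ->; rewrite ?orbT.
- by apply/fsubsetP => k; rewrite !inE => ->; rewrite ?orbT.
Qed.

HB.instance Definition _ := GRing.isLinear.Build rat {malg rat[wmono c]} V *:%R
  (malg_lift F) malg_lift_linear.

Hypothesis Falt : forall m s, F (wswap m s) = - F s.

Lemma fock_lift_pi x : fock_lift F (\pi_(fock c) x) = malg_lift F x.
Proof.
apply/eqP; rewrite -subr_eq0 /fock_lift -linearB /=.
have : repr (\pi_(fock c) x) - x \in @alt_rel c.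
  by apply/pi_fock_eq; rewrite reprK.
move=> /asboolP[l ->]; rewrite linear_sum big1 // => t _.
by rewrite linearZ linearD /= !malg_liftU Falt subrr scaler0.
Qed.

Lemma fock_lift_wedge s : fock_lift F (wedge s) = F s.
Proof. by rewrite fock_lift_pi malg_liftU. Qed.

Lemma fock_lift_linear : linear (fock_lift F).
Proof.
move=> a v w; rewrite -[v]reprK -[w]reprK -pi_fockZ -pi_fockD !fock_lift_pi.
by rewrite linearD linearZ.
Qed.

End Lift.
End FockLmod.

Lemma wedge_tperm c (s t : wmono c) (a b : nat) : (a < b)%N ->
  (forall j, t j = s (if j == a then b else if j == b then a else j)) ->
  wedge t = - wedge s.
Proof.
elim: b s t => // b IH s t; rewrite ltnS leq_eqVlt => /orP[/eqP <-|ab] tE.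
  by rewrite -(wedge_swap a); congr wedge; apply: wmonoP.
apply: oppr_inj; rewrite -(wedge_swap b t) -(wedge_swap b s).
apply: IH => // j; rewrite /= tE /adj; congr (wm_val s _).
by repeat (case: eqP => //); lia.
Qed.

Lemma wedge_eq0 c (s : wmono c) (a b : nat) : (a < b)%N -> s a = s b ->
  wedge s = 0.
Proof.
move=> ab sab; have : wedge s = - wedge s.
  apply: (wedge_tperm ab) => j.
  by case: eqP => [->//|_]; case: eqP => [->|].
move/eqP; rewrite -addr_eq0 -mulr2n -scaler_nat => /eqP w2.
by rewrite -[wedge s]scale1r -(mulVf (_ : 2%:R != 0 :> rat)) // -scalerA w2 scaler0.
Qed.

Section Contraction.
Context (c i : int).

(* At most finitely many m satisfy s m = i. *)
Definition contr_mono (s : wmono c) : fock (c - 1) :=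
  \sum_(m \in [set: nat]) ((-1) ^+ m * (i == s m)%:R : rat) *: wedge (wdel m s).

Lemma contr_monoE (s : wmono c) k : (forall m, (k <= m)%N -> s m != i) ->
  contr_mono s =
  \sum_(0 <= m < k) ((-1) ^+ m * (i == s m)%:R : rat) *: wedge (wdel m s).
Proof.
move=> sk; rewrite /contr_mono.
have -> : [set: nat]%classic = [set` (predT : pred nat)]%classic.
  by apply/seteqP; split.
rewrite -(@bigfs _ _ _ _ (index_iota 0 k)) ?iota_uniq // => m _.
rewrite mem_index_iota -leqNgt => /sk /negPf.
by rewrite eq_sym => ->; rewrite mulr0 scale0r.
Qed.

Lemma contr_bound (s : wmono c) :
  exists k, forall m, (k <= m)%N -> s m != i.
Proof.
have [k hk] := wmono_ex s; exists (k + `|(c - i)%R|.+1)%N => m km.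
by rewrite hk; [apply/eqP; lia|lia].
Qed.

Lemma adjK m : involutive (adj m).
Proof. by move=> j; rewrite /adj; repeat (case: eqP => //); lia. Qed.

Lemma contr_mono_swap m (s : wmono c) :
  contr_mono (wswap m s) = - contr_mono s.
Proof.
rewrite {1}/contr_mono (reindex_fsbigT (adj m) _ (inv_bij (adjK m))).
pose F j := ((-1) ^+ j * (i == s j)%:R : rat) *: wedge (wdel j s).
transitivity (\sum_(j \in [set: nat]) - F j).
  apply: eq_fsbigr => j _; rewrite /F [wm_val (wswap m s) _]/= adjK.
  have [->|jm] := eqVneq j m.
    have -> : adj m m = m.+1 by rewrite /adj eqxx.
    rewrite exprS mulN1r mulNr scaleNr; congr (- (_ *: wedge _)).
    apply: wmonoP => l /=; congr (wm_val s _).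
    by rewrite /adj /bump; repeat case: eqP => //; lia.
  have [->|jm1] := eqVneq j m.+1.
    have -> : adj m m.+1 = m by rewrite /adj eqxx; case: eqP => //; lia.
    rewrite exprS mulN1r mulNr scaleNr opprK; congr (_ *: wedge _).
    apply: wmonoP => l /=; congr (wm_val s _).
    by rewrite /adj /bump; repeat case: eqP => //; lia.
  have -> : adj m j = j by rewrite /adj (negPf jm) (negPf jm1).
  rewrite -scalerN; congr (_ *: _).
  rewrite -(wedge_swap (unbump j m)); congr wedge.
  apply: wmonoP => l /=; congr (wm_val s _).
  move: jm jm1; rewrite /adj /bump /unbump => /eqP jm /eqP jm1.
  by repeat case: eqP => //; lia.
have [k sk] := contr_bound s.
have F0 j : (k <= j)%N -> F j = 0.
  by move=> /sk /negPf; rewrite eq_sym /F => ->; rewrite mulr0 scale0r.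
have -> : [set: nat]%classic = [set` (predT : pred nat)]%classic.
  by apply/seteqP; split.
rewrite -(@bigfs _ _ _ _ (index_iota 0 k)) ?iota_uniq // => [|j _].
  by rewrite sumrN (contr_monoE sk).
by rewrite mem_index_iota -leqNgt => /F0 ->; rewrite oppr0.
Qed.

Definition contr : fock c -> fock (c - 1) := fock_lift contr_mono.

HB.instance Definition _ := GRing.isLinear.Build rat (fock c) (fock (c - 1))
  *:%R contr (fock_lift_linear contr_mono_swap).

Lemma contr_wedge s : contr (wedge s) = contr_mono s.
Proof. exact: fock_lift_wedge contr_mono_swap s. Qed.

End Contraction.

Section Bracket.
Context (r : option nat).

Definition bracket_det (k : nat) (s : wmono 0) : Bring r :=
  \det (\matrix_(a < k, b < k) U_ a (u_ r (s b))).

(* The size of the determinant is irrelevant, see bracket_monoE. *)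
Definition bracket_mono (s : wmono 0) : Bring r :=
  bracket_det (projT1 (cid (wmono_ex s))) s.

Lemma bracket_monoE (s : wmono 0) k :
  (forall m, (k <= m)%N -> s m = 0 - m%:Z) -> bracket_mono s = bracket_det k s.
Proof.
suff H k0 l : (forall m, (k0 <= m)%N -> s m = 0 - m%:Z) ->
    bracket_det (l + k0) s = bracket_det k0 s.
  move=> sk; rewrite /bracket_mono; case: (cid _) => k1 /= sk1.
  by rewrite -(H k1 k sk1) -(H k k1 sk) addnC.
move=> sk; elim: l => // l <-; rewrite addSn.
apply: (@det_last_col _ _ (fun a b => U_ a (u_ r (s b)))) => a ak.
by rewrite sk ?leq_addl // sub0r U_uN.
Qed.

Lemma bracket_mono_swap m (s : wmono 0) :
  bracket_mono (wswap m s) = - bracket_mono s.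
Proof.
have [k0 sk0] := wmono_ex s; pose k := (k0 + m.+2)%N.
have sk j : (k <= j)%N -> s j = 0 - j%:Z by move=> kj; apply: sk0; lia.
have wk j : (k <= j)%N -> wswap m s j = 0 - j%:Z.
  by move=> kj; rewrite -sk //= /adj; do 2![case: eqP => [|_]; first lia].
rewrite (bracket_monoE sk) (bracket_monoE wk) /bracket_det.
have mk : (m < k)%N by lia.
have mk1 : (m.+1 < k)%N by lia.
pose A := \matrix_(a < k, b < k) U_ a (u_ r (s b)).
transitivity (\det (xcol (Ordinal mk) (Ordinal mk1) A)).
  congr (\det _); apply/matrixP => a b; rewrite [LHS]mxE [RHS]mxE [RHS]mxE.
  suff e : adj m b = tperm (Ordinal mk) (Ordinal mk1) b.
    by congr (U_ a (u_ r _)); rewrite [LHS]/= e.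
  rewrite /adj; case: tpermP => [->|->|/eqP bm /eqP bm1] /=; rewrite ?eqxx //.
    by case: eqP => //; lia.
  by move: bm bm1; rewrite -!val_eqE /= => /negPf-> /negPf->.
rewrite xcolE det_mulmx det_perm odd_tperm.
by rewrite (_ : (_ != _) = true) ?mulrN1 // -val_eqE /=; apply/eqP; lia.
Qed.

Definition bracket : fock 0 -> Bring r := fock_lift bracket_mono.

HB.instance Definition _ := GRing.isLinear.Build rat (fock 0) (Bring r)
  *:%R bracket (fock_lift_linear bracket_mono_swap).

Lemma bracket_wedge (s : wmono 0) k : (forall m, (k <= m)%N -> s m = 0 - m%:Z) ->
  bracket (wedge s) = bracket_det k s.
Proof.
move=> sk; rewrite -(bracket_monoE sk).
exact: fock_lift_wedge bracket_mono_swap s.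
Qed.

End Bracket.

Fact Phi_subproof (i : int) (la : seq nat) : exists k, forall m, (k <= m)%N ->
  i - m%:Z + (nth 0%N la m)%:Z = i - m%:Z.
Proof. by exists (size la) => m lam; rewrite nth_default // addr0. Qed.

Definition Phi (i : int) (la : seq nat) : fock i :=
  wedge (mk_wmono (Phi_subproof i la)).

Fact GammaV_subproof r (la : seq nat) : exists N : int, forall n : int, n < N ->
  bracket r (contr (- n) (Phi 1 la)) = 0.
Proof.
exists (- (1 + (sumn la)%:Z)) => n nla.
rewrite /Phi contr_wedge (@contr_monoE _ _ _ 0%N) ?big_geq ?linear0 //= => m _.
have lam : (nth 0%N la m <= sumn la)%N.
  elim: la m {nla} => [|a la IH] [|m] //=; first exact: leq_addr.
  exact: leq_trans (IH m) (leq_addl _ _).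
by apply/eqP; lia.
Qed.

(* The coefficient of z^n comes from the contraction with u_(-n)^v. *)
Definition GammaV_series (r : option nat) (la : seq nat) : laurent (Bring r) :=
  mk_laurent (GammaV_subproof r la).

(* The schur_det k la (h_ r) are the members of a basis of Bring r, so   *)
(* these conditions determine Gamma and G.                               *)
Definition is_GammaV (r : option nat)
    (Gamma : {linear Bring r -> laurent (Bring r)}) : Prop :=
  forall (la : seq nat) (k : nat), is_part r la -> schur_size r la k ->
    Gamma (schur_det k la (h_ r)) = GammaV_series r la.

Definition is_GV (r : option nat)
    (Gamma G : {linear Bring r -> laurent (Bring r)}) : Prop :=
  forall (la : seq nat) (k : nat), is_part r la -> schur_size r la k ->
    G (schur_det k la (h_ r)) =
    lvar (Bring r) * Gamma (schur_det k la (h_ r)) / Eser r.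

(* Main.v *)
Require Import Defs.
From HB Require Import structures.
From mathcomp Require Import all_boot all_order all_algebra.
From mathcomp Require Import finmap boolp classical_sets fsbigop zify.

Set Implicit Arguments.
Unset Strict Implicit.
Unset Printing Implicit Defensive.

Import Order.POrderTheory GRing.Theory.
Local Open Scope ring_scope.

(** Put [a_n = \sum_(j >= 0) h_(n-j) z^(-j)], the part of [z^(-n) / E(z)] with
    exponents [<= 0].  As [a_n - z^(-1) a_(n-1) = h_n], row operations turn the
    determinant of size [N+1] defining [Delta_la(a)] into one whose rows
    [i >= 1] are [h_(p_b + i)], where [p_b = la_b - b], and whose row [0] is
    [a_(p_b)].  Expanding along row [0], a row [h_(p_b + q)] with
    [1 <= q <= N] contributes nothing, so up to [z^N] one may replace
    [a_(p_b)] by [z^(-p_b) / E(z)].  The resulting expansion is, up to [z^N],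
    the contraction defining [z Gamma Delta_la(H) / E(z)].  Hence the latter is
    [Delta_la(a)]; for one-row partitions this says [G h_n = a_n]. *)

(** * Laurent coefficients, constant series, expansion along row 0 *)

Section LaurentCoefficients.
Context (R : comNzRingType).
Implicit Types (f g : laurent R) (c : R).

Lemma lcoef_sum (I : Type) (s : seq I) (P : pred I) (F : I -> laurent R) n :
  (\sum_(i <- s | P i) F i) n = \sum_(i <- s | P i) F i n.
Proof. by elim/big_rec2: _ => // i x f _ <-. Qed.

Lemma lcoef_monomM k f n : (lmonom R k * f) n = f (n - k).
Proof. exact: lmul_monomE. Qed.

Fact lconst_subproof c :
  exists N : int, forall n : int, n < N -> (if n == 0 then c else 0) = 0.
Proof. by exists 0 => n; case: eqP => // ->. Qed.

Definition lconst c : laurent R := mk_laurent (lconst_subproof c).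

Lemma lcoef_constM c f n : (lconst c * f) n = c * f n.
Proof.
rewrite lcoefM (fsbigTE [fset (0 : int)]%fset) => [|i].
  by rewrite big_seq_fset1 /= subr0.
by rewrite inE /= => /negPf ->; rewrite mul0r.
Qed.

Fact lconst_zmod_morphism : zmod_morphism lconst.
Proof.
move=> c d; apply: laurentP => n.
by rewrite lcoefD lcoefN /=; case: eqP; rewrite ?subr0.
Qed.

HB.instance Definition _ :=
  GRing.isZmodMorphism.Build R (laurent R) lconst lconst_zmod_morphism.

Fact lconst_monoid_morphism : monoid_morphism lconst.
Proof.
split; first by apply: laurentP => n; rewrite lcoef1 /=; case: eqP.
move=> c d; apply: laurentP => n; rewrite lcoef_constM /=.
by case: eqP; rewrite ?mulr0.
Qed.

HB.instance Definition _ :=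
  GRing.isMonoidMorphism.Build R (laurent R) lconst lconst_monoid_morphism.

End LaurentCoefficients.

(** The cofactors along row 0 involve only constant rows, so they are constants and can be pulled
    out of the coefficient of [z^q]. *)
Lemma expand_row0_const (R : comNzRingType) n (A : 'M[R]_n.+1)
    (f : 'I_n.+1 -> laurent R) q :
  (\det (\matrix_(i, j) if i == 0 then f j else lconst (A i j))) q =
  \sum_j f j q * cofactor A 0 j.
Proof.
rewrite (expand_det_row _ 0) lcoef_sum; apply: eq_bigr => j _.
rewrite mxE eqxx mulrC [RHS]mulrC.
suff -> : cofactor (\matrix_(i, l) if i == 0 then f l else lconst (A i l)) 0 j
    = lconst (cofactor A 0 j) by rewrite lcoef_constM.
rewrite -cofactor_map_mx /cofactor; congr (_ * \det _).
by apply/matrixP => i l; rewrite !mxE.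
Qed.

(** This is an off-diagonal entry of the scalar matrix [A *m \adj A]. *)
Lemma cofactor_row0_orth (R : comNzRingType) n (A : 'M[R]_n.+1) (i : 'I_n.+1) :
  i != 0 -> \sum_j A i j * cofactor A 0 j = 0.
Proof.
move=> i0; have := congr1 (fun M : 'M_n.+1 => M i 0) (mul_mx_adj A).
rewrite mxE [X in _ = X -> _]mxE (negPf i0) mulr0n => e.
rewrite -[RHS]e; apply: eq_bigr => j _.
by rewrite [(\adj A) _ _]mxE.
Qed.

(** * Schur determinants of the truncated series *)

Section NonpositivePart.
Context (R : comNzRingType) (f : laurent R).

Fact ltail_subproof (n : int) : exists N : int, forall q : int, q < N ->
  (if q <= 0 then f (n + q) else 0) = 0.
Proof.
have [N fN] := laurent_ex f; exists (N - n) => q qn.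
by case: ifP => // _; apply: fN; lia.
Qed.

(* For [f = 1 / E(z)] this is the series [a_n] above. *)
Definition ltail (n : int) : laurent R := mk_laurent (ltail_subproof n).

(** Iterates [a_n = f_n + z^(-1) a_(n-1)]. The sum runs over all [j] so that it reads as a product
    with a unitriangular matrix. *)
Lemma ltail_shift (p : int) n (i : 'I_n.+1) :
  ltail (p + i%:Z) = \sum_(j < n.+1)
    (if (j <= i)%N then lmonom R (j%:Z - i%:Z) else 0) *
    (if j == 0 then ltail p else lconst (f (p + j%:Z))).
Proof.
apply: laurentP => q; rewrite lcoef_sum big_ord_recl leq0n eqxx.
rewrite lcoef_monomM.
have cE (j : 'I_n) : ((if (lift ord0 j <= i)%N
      then lmonom R ((lift ord0 j)%:Z - i%:Z) else 0) *
    (if lift ord0 j == 0 then ltail p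
     else lconst (f (p + (lift ord0 j)%:Z)))) q =
    if (j.+1 <= i)%N && (q == j.+1%:Z - i%:Z) then f (p + j.+1%:Z) else 0.
  rewrite (_ : (lift ord0 j == 0) = false) //; case: ifP => ji; last by rewrite mul0r.
  by rewrite lcoef_monomM /= subr_eq0 /bump /= add1n.
rewrite (eq_bigr _ (fun j _ => cE j)) /=.
have ni := ltn_ord i.
(* The exponent [q] is reached only by the term [j = 0] if [q + i <= 0], and otherwise only by
   [j = q + i], which satisfies [j <= i] exactly when [q <= 0]. *)
have [qi|qi] := boolP (q - (0%:Z - i%:Z) <= 0).
  rewrite big1 => [|j _]; last by rewrite ifF //; lia.
  by rewrite addr0 ifT; [congr (f _)|]; lia.
case: ifP => q0; last by rewrite big1 ?addr0 // => j _; rewrite ifF //; lia.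
have jn : (`|(q + i%:Z)%R|.-1 < n)%N by lia.
rewrite (bigD1 (Ordinal jn)) //= ifT; last by lia.
rewrite big1 => [|j]; last by rewrite -val_eqE /= => jne; rewrite ifF //; lia.
by rewrite add0r addr0; congr (f _); lia.
Qed.

Definition jt_matrix (la : seq nat) (n : nat) : 'M[R]_n.+1 :=
  \matrix_(i, j) f ((nth 0%N la j)%:Z - j%:Z + i%:Z).

Lemma schur_det_ltail_row0 (la : seq nat) n :
  schur_det n.+1 la ltail =
  \det (\matrix_(i < n.+1, j < n.+1)
     if i == 0 then ltail ((nth 0%N la j)%:Z - j%:Z)
     else lconst (jt_matrix la n i j)).
Proof.
pose T : 'M[laurent R]_n.+1 := \matrix_(i, j)
  if (j <= i)%N then lmonom R (j%:Z - i%:Z) else 0.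
have detT : \det T = 1.
  rewrite det_trig => [|]; first by rewrite big1 // => i _; rewrite mxE leqnn subrr.
  by apply/is_trig_mxP => i j ij; rewrite mxE leqNgt ij.
rewrite /schur_det -[RHS]mul1r -detT -det_mulmx; congr (\det _).
apply/matrixP => i j; rewrite !mxE ltail_shift.
by apply: eq_bigr => l _; rewrite !mxE.
Qed.

(** For [q <= 0] the cutoff in [ltail] has no effect. For [1 <= q <= n] both sides vanish: [ltail]
    has no positive exponents, and on the right row [q] of [jt_matrix] is paired with the cofactors
    of row 0. *)
Lemma lcoef_schur_ltail (la : seq nat) n (q : int) : q <= n%:Z ->
  schur_det n.+1 la ltail q =
  \sum_(j < n.+1) f ((nth 0%N la j)%:Z - j%:Z + q) * cofactor (jt_matrix la n) 0 j.
Proof.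
move=> qn; rewrite schur_det_ltail_row0 expand_row0_const /=.
have [q0|q0] := boolP (q <= 0); first by apply: eq_bigr.
rewrite big1 => [|j _]; last by rewrite mul0r.
have qlt : (`|q| < n.+1)%N by lia.
rewrite -[LHS](@cofactor_row0_orth _ _ (jt_matrix la n) (Ordinal qlt)).
  by apply: eq_bigr => j _; rewrite mxE /=; congr (f _ * _); lia.
by rewrite -val_eqE /=; lia.
Qed.

Hypothesis f_lt0 : forall n : int, n < 0 -> f n = 0.

Lemma ltail_lt0 (n : int) : n < 0 -> ltail n = 0.
Proof.
move=> n0; apply: laurentP => q; rewrite lcoef0 /=.
by case: ifP => // q0; apply: f_lt0; lia.
Qed.

Lemma ltail_0 : f 0 = 1 -> ltail 0 = 1.
Proof.
move=> f0; apply: laurentP => q; rewrite lcoef1 /= add0r.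
have [->|q0] := eqVneq q 0; first exact: f0.
by case: ifP => // le; apply: f_lt0; lia.
Qed.

End NonpositivePart.

(** * Brackets as determinants in the [h_n], and the contraction series *)

Lemma sum_rev_widen (V : nmodType) (F : nat -> nat -> V) (a k : nat) : (a < k)%N ->
  \sum_(i < a.+1) F i (a - i)%N =
  \sum_(i < k) if (i <= a)%N then F (a - i)%N i else 0.
Proof.
move=> ak; transitivity (\sum_(i < a.+1) F (a - i)%N i); last first.
  rewrite (big_ord_widen k (fun i => F (a - i)%N i) ak) big_mkcond.
  by apply: eq_bigr => i _; rewrite ltnS.
rewrite (reindex_inj rev_ord_inj); apply: eq_bigr => i _ /=.
by rewrite subSS subKn // -ltnS.
Qed.

(** The convolution is left multiplication by the lower unitriangular Toeplitz matrix of [c]. *)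
Lemma det_row_convolution (R : comNzRingType) (c : nat -> R)
    (M : nat -> nat -> R) k : c 0%N = 1 ->
  \det (\matrix_(a < k, b < k) \sum_(i < a.+1) c i * M (a - i)%N b) =
  \det (\matrix_(a < k, b < k) M a b).
Proof.
move=> c0; pose T : 'M[R]_k := \matrix_(a, i) if (i <= a)%N then c (a - i)%N else 0.
have detT : \det T = 1.
  rewrite det_trig => [|]; last first.
    by apply/is_trig_mxP => i j ij; rewrite mxE leqNgt ij.
  by rewrite big1 // => i _; rewrite mxE leqnn subnn.
rewrite -[RHS]mul1r -detT -det_mulmx; congr (\det _).
apply/matrixP => a b; rewrite !mxE.
rewrite (sum_rev_widen (fun i j => c i * M j b) (ltn_ord a)).
by apply: eq_bigr => i _; rewrite !mxE; case: ifP; rewrite ?mul0r.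
Qed.

Section Bracket.
Context (r : option nat).
Local Notation htail := (ltail (Eser r)^-1).
Local Notation hmatrix := (jt_matrix (Eser r)^-1).

Let htail_0 : htail 0 = 1. Proof. exact: ltail_0 (@h_lt0 r) (@h_0 r). Qed.
Let htail_lt0 := ltail_lt0 (@h_lt0 r).

Lemma bracket_detE k (s : wmono 0) :
  bracket_det r k s = \det (\matrix_(a < k, b < k) h_ r (a%:Z + s b)).
Proof.
rewrite -(@det_row_convolution _ (fun i => (-1) ^+ i * e_ r i)
  (fun a b => h_ r (a%:Z + s b))); last by rewrite e_0 mulr1.
by congr (\det _); apply/matrixP => a b; rewrite [LHS]mxE [RHS]mxE U_u.
Qed.

(** Contracting at position [m] deletes column [m]. Charge 1 shifts the rows by one, so the bracket
    is a minor of [hmatrix] avoiding row 0, and the contraction sign turns it into a cofactor. *)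
Lemma lcoef_GammaV (la : seq nat) n (q : int) : (size la <= n)%N -> q <= n%:Z ->
  (lvar _ * GammaV_series r la) q =
  (\sum_(j < n.+1) lmonom (Bring r) (- ((nth 0%N la j)%:Z - j%:Z)) *
     lconst (cofactor (hmatrix la n) 0 j)) q.
Proof.
move=> lan qn; rewrite lcoef_monomM [LHS]/= /Phi contr_wedge.
(* For [m > n] the index at position [m] is [1 - m], below the contracted index [1 - q] because
   [q <= n]. *)
rewrite (@contr_monoE _ _ _ n.+1) => [|m nm /=]; last first.
  by rewrite nth_default; [apply/eqP; lia|lia].
rewrite linear_sum lcoef_sum big_mkord; apply: eq_bigr => m _.
(* After the deletion, the index at a position [j >= n] is [1 - (j + 1) = - j], so size [n]
   suffices. *)
rewrite lcoef_monomM linearZ /= (@bracket_wedge _ _ n) => [|j nj]; last first.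
  have mj : (m <= j)%N by rewrite -ltnS (leq_trans (ltn_ord m)).
  by rewrite /= /bump mj add1n nth_default; lia.
rewrite bracket_detE.
rewrite (_ : (_ == 0) = (- (q - 1) == 1 - m%:Z + (nth 0%N la m)%:Z)); last by lia.
case: eqP => _; last by rewrite mulr0 scale0r.
rewrite mulr1 /cofactor add0n -signr_odd scaler_sign -[in RHS]signr_odd mulr_sign.
have -> : \matrix_(a < n, b < n) h_ r (a%:Z +
    wdel m (mk_wmono (Phi_subproof 1 la)) b) =
    row' 0 (col' m (hmatrix la n)).
  by apply/matrixP => a b; rewrite !mxE /=; congr h_; rewrite /bump; lia.
by [].
Qed.

(** The series [1 / Eser r] has no negative exponents. *)
Lemma lcoef_div_Eser (f g : laurent (Bring r)) (n : int) :
  (forall q, q <= n -> f q = g q) -> (f / Eser r) n = (g / Eser r) n.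
Proof.
move=> fg; rewrite !lcoefM; apply: eq_fsbigr => i _.
have [/fg -> //|ni] := boolP (i <= n).
by rewrite -/(h_ r (n - i)) h_lt0 ?mulr0 //; lia.
Qed.

Lemma GammaV_div_Eser (la : seq nat) k : (size la <= k)%N ->
  lvar _ * GammaV_series r la / Eser r = schur_det k la htail.
Proof.
(* The size [n] depends on [q], as both truncated formulas require [q <= n]. Resizing is harmless:
   [htail] is 1 at 0 and vanishes at negative indices. *)
move=> lak; apply: laurentP => q; pose n := (size la + `|q|)%N.
rewrite (schur_det_size htail_0 htail_lt0 lak).
rewrite -(@schur_det_size _ n.+1 _ _ htail_0 htail_lt0); last by lia.
have qn : q <= n%:Z by lia.
rewrite lcoef_schur_ltail //.
rewrite (lcoef_div_Eser (fun p pq =>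
  lcoef_GammaV (leq_addr _ _) (le_trans pq qn))).
rewrite mulr_suml lcoef_sum; apply: eq_bigr => j _.
rewrite -mulrA lcoef_monomM lcoef_constM mulrC opprK addrC.
by congr (_ * _); rewrite -/(h_ r _) addrC.
Qed.

End Bracket.

(** Partitions list nonzero parts only, so [n = 0] is the empty partition. *)
Lemma schur_det_row (R : comNzRingType) (k n : nat) (la : seq nat) (a : int -> R) :
  a 0 = 1 -> (forall m : int, m < 0 -> a m = 0) -> (0 < k)%N ->
  la = (if n == 0%N then [::] else [:: n]) -> schur_det k la a = a n%:Z.
Proof.
move=> a0 an0 k0 laE.
rewrite (schur_det_size a0 an0) laE; last by case: eqP.
case: eqP => [->|_]; first by rewrite /schur_det det_mx00.
by rewrite /schur_det det_mx11 mxE subr0 addr0.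
Qed.

Theorem theorem7p3 (r : option nat) (hr : le_oo 1 r)
    (Gamma G : {linear Bring r -> laurent (Bring r)})
    (hGamma : is_GammaV Gamma) (hG : is_GV Gamma G)
    (la : seq nat) (k : nat) (hla : is_part r la) (hk : schur_size r la k) :
  G (schur_det k la (h_ r)) = schur_det k la (fun n => G (h_ r n)) /\
  Gamma (schur_det k la (h_ r)) =
    Eser r / lvar (Bring r) * schur_det k la (fun n => G (h_ r n)).
Proof.
have GE mu l : is_part r mu -> schur_size r mu l ->
    G (schur_det l mu (h_ r)) = schur_det l mu (ltail (Eser r)^-1).
  move=> mup lmu; rewrite hG // hGamma // (@GammaV_div_Eser _ _ l) //.
  by case: (r) mup lmu => [s|] //= /and3P[_ _ ?] /eqP ->.
(* For [n >= 0], [h_n] is itself a Schur determinant with at most one part, so [GE] evaluates [G] on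
   it. *)
have Gh n : G (h_ r n) = ltail (Eser r)^-1 n.
  have t0 := ltail_0 (@h_lt0 r) (@h_0 r).
  case: n => [n|n]; last by rewrite h_lt0 // (ltail_lt0 (@h_lt0 r)) // linear0.
  pose mu := if n == 0%N then [::] else [:: n].
  (* An admissible size, positive by [hr]. *)
  pose l := if r is Some s then s else 1%N.
  have l0 : (0 < l)%N by rewrite /l; case: (r) hr.
  rewrite -(schur_det_row (@h_0 r) (@h_lt0 r) l0 (erefl mu)).
  rewrite GE ?(schur_det_row t0 (ltail_lt0 (@h_lt0 r)) l0 (erefl mu)) //.
    by rewrite /is_part /mu; case: n {mu} => [|n]; case: (r) hr.
  by rewrite /l /mu; case: (r) => //=; case: eqP.
have GL : G (schur_det k la (h_ r)) = schur_det k la (fun n => G (h_ r n)).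
  by rewrite GE //; congr (schur_det k la _); apply: funext => n; rewrite Gh.
split=> //; rewrite -GL hG // mulrC mulrA divrK ?Eser_unit //.
by rewrite mulrAC divrr ?mul1r ?lvar_unit.
Qed.
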